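(* Let $S$ be an inverse semigroup. Then $S$ has rational word problem if and only if $S$ is finite.
   Context: A semigroup $S$ is inverse if for every $u\in S$ there is a unique $v\in S$ with $uvu=u$ and $vuv=v$. For a finite set $A$, $A^+$ denotes the set of all non-empty finite strings over $A$, and $\epsilon$ denotes the empty string. For a semigroup $S$ generated (as a semigroup) by a finite set $A$, the (two-tape) word problem of $S$ with respect to $A$ is the relation $\iota(S,A)=\{(u,v)\in A^+\times A^+ \mid u =_S v\}$, where $u=_S v$ means that the strings $u$ and $v$ represent the same element of $S$. A two-tape asynchronous finite state automaton (AFSA) is a tuple $\mathcal{A}=(Q,q_0,A,F,\Delta)$ where $Q$ is a finite set of states, $q_0\in Q$ is the start state, $A$ is a finite alphabet, $F\subseteq Q$ is the set of final states, and $\Delta\subseteq Q\times(A\cup\{\epsilon\})\times(A\cup\{\epsilon\})\times Q$ is the transition relation. The automaton takes as input a pair $(u,v)\in A^+\times A^+$, starts in state $q_0$ and reads both tapes from left to right: when in state $p$, for any $(p,a,b,q)\in\Delta$ it may move to state $q$ if the current symbols on the first and second tapes are $a$ and $b$ respectively, consuming these symbols; if $a=\epsilon$ (respectively $b=\epsilon$), no input is consumed from the first (respectively second) tape. The pair $(u,v)$ is accepted if it is possible for $\mathcal{A}$ to be in a final state after reading all of $(u,v)$. A relation $\rho\subseteq A^+\times A^+$ is rational if there is an AFSA such that the set of pairs in $A^+\times A^+$ accepted by it is exactly $\rho$. A semigroup $S$ has rational word problem if it is generated as a semigroup by some finite set $A$ such that $\iota(S,A)$ is rational (it is known that rationality does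 not depend on the choice of finite generating set). In particular, having rational word problem includes being finitely generated. *)

(* Defs.v *)
From HB Require Import structures.
From mathcomp Require Import all_boot finmap.
From mathcomp Require Import boolp classical_sets cardinality.

Set Implicit Arguments.
Unset Strict Implicit.
Unset Printing Implicit Defensive.

Local Open Scope classical_set_scope.

Definition inverse_semigroup (S : semigroupType) : Prop :=
  forall u : S, exists! v : S, (u * v * u = u)%g /\ (v * u * v = v)%g.

(* A^+ *)
Definition nonempty_strings (A : Type) : set (seq A) := [set w | w <> [::]].
Arguments nonempty_strings : clear implicits.

(* None stands for the empty symbol epsilon in transitions. *)
Record afsa (A : finType) := Afsa {
  state : finType;
  start : state;
  final : {set state};
  trans : {set state * option A * option A * state}
}.

(* run M p u v q: M can go from state p to state q while consuming exactly u on
   the first tape and v on the second one; seq_of_opt maps Some a to the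
   one-letter string a and None to the empty string. *)
Inductive run (A : finType) (M : afsa A) :
    state M -> seq A -> seq A -> state M -> Prop :=
| run_nil p : run p [::] [::] p
| run_step p (a b : option A) q u v r :
    (p, a, b, q) \in trans M -> run q u v r ->
    run p (seq_of_opt a ++ u) (seq_of_opt b ++ v) r.

Definition accepts (A : finType) (M : afsa A) (u v : seq A) : Prop :=
  exists2 q, q \in final M & run (start M) u v q.

Definition rational (A : finType) (rho : set (seq A * seq A)) : Prop :=
  exists M : afsa A,
    (nonempty_strings A `*` nonempty_strings A) `&`
      [set uv | accepts M uv.1 uv.2] = rho.

(* The element of S represented by a string over A; the empty string represents
   nothing, as S need not have an identity. *)
Definition value (S : semigroupType) (A : {fset S}) (w : seq A) : option S :=
  if w is a :: w' then Some (foldl (fun (x : S) (b : A) => x * val b)%g (val a) w')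
  else None.

Definition generates (S : semigroupType) (A : {fset S}) : Prop :=
  forall s : S, exists2 w, nonempty_strings A w & value w = Some s.

Definition word_problem (S : semigroupType) (A : {fset S}) : set (seq A * seq A) :=
  (nonempty_strings A `*` nonempty_strings A) `&`
    [set uv | value uv.1 = value uv.2].

Definition rational_word_problem (S : semigroupType) : Prop :=
  exists2 A : {fset S}, generates A & rational (@word_problem S A).

(* Main.v *)
Require Import Defs.
From HB Require Import structures.
From mathcomp Require Import all_boot finmap.
From mathcomp Require Import boolp classical_sets cardinality.

(* For an idempotent e, let w be a word for e and let B be a concatenation of
   round trips u_v u'_v, where u_v and u'_v represent v and an inverse of v, for
   any finite set of elements v of the R-class of e. The pair (w B^k, w) lies in
   the word problem, and for k > |w| some copy of B is read while the second
   head does not move. If the states reached after u_v and u_v' within that copy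
   coincide, then u_v u'_v' may be substituted for B, so v v'^-1 = e and v = v'.
   Hence every R-class has at most as many elements as the automaton has states.
   As S is finitely generated, right multiplication on an R-class is then one of
   finitely many partial automata of bounded size, and an element of S is
   determined by its action on these. *)

Set Implicit Arguments.
Unset Strict Implicit.
Unset Printing Implicit Defensive.

Local Open Scope group_scope.

(** * Idempotents and R-classes in inverse semigroups *)

Section Inverse.
Variables (S : semigroupType) (hS : inverse_semigroup S).

Definition inverses (x y : S) : Prop := x * y * x = x /\ y * x * y = y.

Lemma inverses_inj x y z : inverses x z -> inverses y z -> x = y.
Proof.
move=> [xz zx] [yz zy]; have [t [_ uniq_t]] := hS z.
by rewrite -(uniq_t x) // -(uniq_t y).
Qed.

(** If [x] is the inverse of [e * f], then [f * x * e] is an idempotent inverse of [e * f]. Being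
    also its own inverse, it equals [e * f] by uniqueness. *)
Lemma idem_mul (e f : S) : e * e = e -> f * f = f -> (e * f) * (e * f) = e * f.
Proof.
move=> ee ff; have [x [[h1 h2] _]] := hS (e * f).
have h1' : e * (f * (x * (e * f))) = e * f by rewrite -[RHS]h1 !mulgA.
have h2' : x * (e * (f * x)) = x by rewrite -[RHS]h2 !mulgA.
have efy : inverses (e * f) (f * x * e).
  split.
    by rewrite -!mulgA (mulgA f f) ff (mulgA e e) ee h1'.
  by rewrite -!mulgA (mulgA f f) ff (mulgA e e) ee -{3}h2' -!mulgA.
have idy : (f * x * e) * (f * x * e) = f * x * e.
  by rewrite -!mulgA -{3}h2' -!mulgA.
have yy : inverses (f * x * e) (f * x * e) by split; rewrite !idy.
by rewrite (inverses_inj efy yy) idy.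
Qed.

(** Since both products are idempotent, [e * f] and [f * e] are each an inverse of [e * f]. *)
Lemma idem_comm (e f : S) : e * e = e -> f * f = f -> e * f = f * e.
Proof.
move=> ee ff; have efK := idem_mul ee ff; have feK := idem_mul ff ee.
have efef : inverses (e * f) (e * f) by split; rewrite !efK.
apply: (inverses_inj efef); split.
  by rewrite -!mulgA (mulgA e e) ee (mulgA f f) ff mulgA feK.
by rewrite -!mulgA (mulgA f f) ff (mulgA e e) ee mulgA efK.
Qed.

(** For idempotent [e] this is Green's R-class: [x] lies in [eS] and [e] lies in [xS]. *)
Definition Rclass (e : S) : set S :=
  [set x | e * x = x /\ exists y, x * y = e].

Lemma Rclass_inv e x : e * e = e -> Rclass e x ->
  exists y, [/\ e * x = x, x * y = e & y * e = y].
Proof.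
move=> ee [ex [y xy]]; exists (y * e).
by rewrite mulgA xy -[y * e * e]mulgA ee.
Qed.

(** A path inside [eS] that leaves the R-class never returns, so a sink state can stand for
    everything outside. *)
Lemma Rclass_prefix e x a : e * x = x -> Rclass e (x * a) -> Rclass e x.
Proof. by move=> ex [_ [y xay]]; split=> //; exists (a * y); rewrite mulgA. Qed.

End Inverse.

(** * Cutting and pasting runs *)

Section Runs.
Variables (A : finType) (M : afsa A).
Implicit Types (p q : state M) (u v : seq A).

Lemma run_cat p q r u v u' v' :
  run p u v q -> run q u' v' r -> run p (u ++ u') (v ++ v') r.
Proof.
elim=> // {}p a b {}q' {}u {}v {}q tr _ IH /IH{}IH.
by rewrite -!catA; apply: run_step tr IH.
Qed.

Lemma run_catl p q u v w : run p (u ++ v) w q ->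
  exists r w1 w2, [/\ w = w1 ++ w2, run p u w1 r & run r v w2 q].
Proof.
move E: (u ++ v) => uv h; elim: h u E => [{}p|{}p a b {}q x y r tr h IH] u E.
  exists p, [::], [::]; case: u E => //= ->; by split; constructor.
case: u E => [|c u] E.
  exists p, [::], (seq_of_opt b ++ y); split=> //; first by constructor.
  by rewrite /= in E; rewrite E; apply: run_step tr h.
case: a tr E => [a|] tr /= E.
  case: E => -> /IH [r' [w1 [w2 [-> h1 h2]]]].
  exists r', (seq_of_opt b ++ w1), w2; split=> //; first by rewrite catA.
  exact: (run_step tr h1).
have [r' [w1 [w2 [-> h1 h2]]]] := IH (c :: u) E.
exists r', (seq_of_opt b ++ w1), w2; split=> //; first by rewrite catA.
exact: (run_step tr h1).
Qed.

(** Induction on [k]: the first copy of [B] either reads nothing from the second tape or shortens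
    [w], which keeps the bound for the remaining copies. *)
Lemma run_stationary_block p q B k w :
    size w < k -> run p (flatten (nseq k B)) w q ->
  exists i j r r' w1 w2, [/\ w = w1 ++ w2,
    run p (flatten (nseq i B)) w1 r, run r B [::] r' &
    run r' (flatten (nseq j B)) w2 q].
Proof.
elim: k p w => // k IH p w szw /= /run_catl [r [w1 [w2 [E h1 h2]]]].
case: w1 => [|a w1] in E h1.
  by exists 0, k, p, r, [::], w; split=> //; [constructor|rewrite E].
have [|i [j [s [s' [v1 [v2 [E2 g1 g2 g3]]]]]]] := IH _ _ _ h2.
  by move: szw; rewrite E /= size_cat ltnS => /(leq_ltn_trans (leq_addl _ _)).
exists i.+1, j, s, s', ((a :: w1) ++ v1), v2; split=> //.
  by rewrite E E2 catA.
exact: run_cat h1 g1.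
Qed.

End Runs.

(** * Words acting by right multiplication *)

Section Words.
Variables (S : semigroupType) (A : {fset S}).
Implicit Types (s t e : S) (u v w : seq A).

(** Unlike [value], this is total: the empty word acts as the identity. *)
Definition act s w : S := foldl (fun (x : S) (b : A) => x * val b) s w.

Lemma act_cat s u v : act s (u ++ v) = act (act s u) v.
Proof. exact: foldl_cat. Qed.

Lemma act_mul s t u : act (s * t) u = s * act t u.
Proof. by elim: u t => //= a u IH t; rewrite -mulgA IH. Qed.

Lemma act_value s t u : value u = Some t -> act s u = s * t.
Proof. by case: u => //= a u [<-]; rewrite -/(act _ _) act_mul. Qed.

Lemma value_cat t u v : value u = Some t -> value (u ++ v) = Some (act t v).
Proof. by case: u => //= a u [<-]; rewrite foldl_cat. Qed.

Lemma act_flatten s (bs : seq (seq A)) :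
  (forall b, b \in bs -> act s b = s) -> act s (flatten bs) = s.
Proof.
elim: bs => //= b bs IH h; rewrite act_cat h ?mem_head // IH // => c cbs.
by apply: h; rewrite inE cbs orbT.
Qed.

Hypothesis genA : generates A.

Lemma word_ex s : exists w, value w = Some s.
Proof. by have [w _] := genA s; exists w. Qed.

Definition word s : seq A := sval (cid (word_ex s)).

Lemma value_word s : value (word s) = Some s.
Proof. by rewrite /word; case: cid. Qed.

Lemma act_word s t : act s (word t) = s * t.
Proof. exact/act_value/value_word. Qed.

End Words.

(** * Rational word problem implies finiteness *)

Section RationalFinite.
Variables (S : semigroupType) (hS : inverse_semigroup S).
Variables (A : {fset S}) (genA : generates A) (M : afsa A).
Hypothesis MP : forall (u v : seq A),
  u <> [::] -> v <> [::] -> accepts M u v <-> value u = value v.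

Lemma Rclass_seq_bound e (l : seq S) : e * e = e -> uniq l ->
  (forall x, x \in l -> Rclass e x) -> size l <= #|state M|.
Proof.
move=> ee uniq_l lR.
(* The normalisation [y * e = y] makes [y] the inverse of [x]. *)
have /choice [inv invP] x : exists y, x \in l ->
    [/\ e * x = x, x * y = e & y * e = y].
  have [/lR/(Rclass_inv ee) [y yP]|xl] := boolP (x \in l); first by exists y.
  by exists x.
pose trip x := word genA x ++ word genA (inv x).
have tripE s x : s * e = s -> x \in l -> act s (trip x) = s.
  by move=> se /invP [_ xy _]; rewrite act_cat !act_word -mulgA xy.
pose trips (m : seq S) := flatten (map trip m).
have tripsE s (m : seq S) : s * e = s -> {subset m <= l} -> act s (trips m) = s.
  by move=> se ml; apply: act_flatten => b /mapP [x /ml xl ->]; apply: tripE.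
set w := word genA e; set k := (size w).+1.
have wE : value w = Some e by exact: value_word.
have powE s i : s * e = s -> act s (flatten (nseq i (trips l))) = s.
  move=> se; apply: act_flatten => b; rewrite mem_nseq => /andP [_ /eqP ->].
  exact: tripsE.
have w_neq0 : w <> [::] by move=> w0; rewrite w0 in wE.
have w_cat_neq0 v : w ++ v <> [::] by case: (w) w_neq0.
have [qf qfF] : accepts M (w ++ flatten (nseq k (trips l))) w.
  by rewrite MP // (value_cat _ wE) powE.
case/run_catl=> q0 [w1 [w2 [Ew run0]]].
have ltk : size w2 < k by rewrite ltnS Ew size_cat leq_addl.
case/(run_stationary_block ltk)=> i [j [r [r' [w3 [w4 [Ew2 run1 run2 run3]]]]]].
(* Cut the stationary copy right after the word for [x]. The other round trips fix [e], so [X] takes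
   [e] to [x] and [Y] multiplies by [inv x]. *)
have midP x : x \in l -> exists q X Y, [/\ run r X [::] q, run q Y [::] r',
    act e X = x & forall s, act s Y = s * inv x].
  move=> xl; have [ex xy ye] := invP _ xl.
  case/path.splitPr: xl (run2) (tripsE) => l1 l2 {}run2 {}tripsE.
  rewrite /trips map_cat flatten_cat /= /trip -catA catA in run2.
  case/run_catl: run2 => q [[|? ?] [[|? ?] [// _ h1 h2]]].
  exists q, (trips l1 ++ word genA x), (word genA (inv x) ++ trips l2).
  split=> //.
    by rewrite act_cat act_word tripsE // => z zl; rewrite mem_cat zl.
  move=> s; rewrite act_cat act_word tripsE -?mulgA ?ye // => z zl.
  by rewrite mem_cat inE zl !orbT.
have /choice [c cP] x : exists q, x \in l -> exists X Y,
    [/\ run r X [::] q, run q Y [::] r',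
    act e X = x & forall s, act s Y = s * inv x].
  by have [/midP [q ?]|//] := boolP (x \in l); [exists q|exists r].
have c_inj : {in l &, injective c}.
  move=> x y xl yl cxy; have [X [_ [runX _ XE _]]] := cP _ xl.
  have [_ [Y [_ runY _ YE]]] := cP _ yl; rewrite -cxy in runY.
  (* The first half for [x] is glued to the second half for [y] at their common state; neither half
     reads the second tape, which therefore stays [w]. *)
  have acc : accepts M (w ++ (flatten (nseq i (trips l)) ++ ((X ++ Y) ++
      flatten (nseq j (trips l))))) w.
    exists qf => //; rewrite {2}Ew Ew2; apply: run_cat run0 _.
    apply: run_cat run1 _; apply: (@run_cat _ _ _ r' _ _ [::]) run3.
    exact: run_cat runX runY.
  move/MP: acc => /(_ (w_cat_neq0 _) w_neq0).
  rewrite (value_cat _ wE) wE => -[].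
  have [ex _ _] := invP _ xl; have [ey yiy iye] := invP _ yl.
  rewrite !act_cat (powE e) // XE YE powE -?mulgA ?iye // => xiy.
  (* Both [x] and [y] turn out to be inverses of [inv y]. *)
  have iyP z : e * z = z -> z * inv y = e -> inverses z (inv y).
    by move=> ez ziy; split; rewrite ?ziy // -mulgA ziy.
  exact: (inverses_inj hS (iyP x ex xiy) (iyP y ey yiy)).
have /card_uniqP : uniq (map c l) by rewrite map_inj_in_uniq.
rewrite size_map => <-.
exact: max_card.
Qed.

(** The code type is the same for every [e], so that all R-classes give automata in one finite type;
    [None] encodes the outside of the class. *)
Lemma Rclass_coding e : e * e = e ->
  exists phi : S -> option 'I_#|state M|,
    (forall x, Rclass e x <-> phi x <> None) /\
    (forall x y, Rclass e x -> phi x = phi y -> x = y).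
Proof.
move=> ee; have finR : finite_set (Rclass e).
  apply: contrapT => /(@infinite_set_fset _ _ #|state M|.+1) [D DR].
  by rewrite ltnNge (@Rclass_seq_bound e) ?fset_uniq.
pose D := fset_set (Rclass e).
have DP x : Rclass e x <-> x \in D.
  by rewrite /D in_fset_set // inE.
have leD : #|` D| <= #|state M|.
  by apply: (Rclass_seq_bound ee) => [|x /DP]; first exact: fset_uniq.
pose phi x := omap (widen_ord leD) (insub (index x D)).
have phiP x : Rclass e x <-> phi x <> None.
  by rewrite DP -index_mem /phi; case: insubP => [i ->|/negbTE ->].
exists phi; split=> // x y /DP xD.
have xD' := xD; rewrite -index_mem in xD'.
rewrite /phi insubT; case: insubP => //= j yD' jy [E].
have {}E : index x D = index y D by rewrite E jy.
by rewrite -(nth_index x xD) E nth_index // -index_mem.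
Qed.

Lemma inverse_rational_finite : finite_set (@setT S).
Proof.
pose K : finType := option 'I_#|state M|.
pose dfa : finType := ({ffun A * K -> K} * K)%type.
(* The profile of [s] lists the states that all automata on [K], from all start states, reach on a
   chosen word for [s]. *)
pose prof (s : S) : {ffun dfa -> K} :=
  [ffun d : dfa => foldl (fun k a => d.1 (a, k)) d.2 (word genA s)].
have prof_act e s t : e * e = e -> Rclass e s -> e * s = s ->
    prof s = prof t -> e * t = s.
  move=> ee sR es pst; have [phi [phiP phiI]] := Rclass_coding ee.
  (* Right multiplication by letters, transported along [phi]; [None] is a sink. *)
  pose delta : {ffun A * K -> K} := [ffun ak =>
    if pselect (exists x, [/\ Rclass e x & phi x = ak.2]) is left h
    then phi (sval (cid h) * val ak.1) else None].
  have deltaE x u : e * x = x ->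
      foldl (fun k a => delta (a, k)) (phi x) u = phi (act x u).
    elim: u x => //= a u IH x ex; rewrite -IH ?mulgA ?ex //; congr foldl.
    rewrite ffunE /=; case: pselect => [h|h].
      by case: cid => y [yR /= /(phiI _ _ yR) ->].
    apply/esym; apply: contrapT => /phiP /(Rclass_prefix ex) xR.
    by apply: h; exists x.
  have profE u : prof u (delta, phi e) = phi (e * u).
    by rewrite ffunE /= deltaE // act_word.
  by apply/esym/(phiI _ _ sR); rewrite -profE -pst profE es.
have prof_inj : injective prof.
  move=> s t pst; have [s' [[ss' s's] _]] := hS s.
  have [t' [[tt' t't] _]] := hS t.
  have es : (s * s') * (s * s') = s * s' by rewrite mulgA ss'.
  have et : (t * t') * (t * t') = t * t' by rewrite mulgA tt'.
  (* In the natural partial order, [Es] says that [s] is below [t] and [Et] the converse; commuting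
     idempotents give antisymmetry. *)
  have Es := prof_act _ s t es (conj ss' (ex_intro _ s' erefl)) ss' pst.
  have Et := prof_act _ t s et (conj tt' (ex_intro _ t' erefl)) tt' (esym pst).
  rewrite -[RHS]Et -[in RHS]Es [RHS]mulgA -(idem_comm hS es et).
  by rewrite -[RHS]mulgA tt' Es.
rewrite -(preimage_setT prof); apply: finite_preimage finite_finset.
by move=> x y _ _; apply: prof_inj.
Qed.
End RationalFinite.

(** * Finite semigroups have rational word problem *)

Section FiniteRational.
Variables (S : semigroupType) (A : {fset S}).
Hypothesis AT : forall s : S, s \in A.

(** Multiplication in S with an identity [None] adjoined, the value of the empty prefix. *)
Definition step_mul (x a : option A) : option A :=
  match x, a with
  | Some y, Some b => Some [` AT (val y * val b)]%fset
  | None, _ => a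
  | _, None => x
  end.

(** A state stores the values of the prefixes read so far on the two tapes. *)
Definition value_afsa : afsa A := {|
  state := (option A * option A)%type;
  start := (None, None);
  final := [set p | p.1 == p.2]%SET;
  trans := [set t : (option A * option A) * option A * option A *
                 (option A * option A) |
    t.2 == (step_mul t.1.1.1.1 t.1.1.2, step_mul t.1.1.1.2 t.1.2)]%SET |}.

Definition eval_from (x : option A) (u : seq A) : option A :=
  foldl (fun y b => step_mul y (Some b)) x u.

Lemma eval_from_cat x a u :
  eval_from x (seq_of_opt a ++ u) = eval_from (step_mul x a) u.
Proof. by case: a => //=; case: x. Qed.

Lemma run_value_afsa (p q : state value_afsa) u v :
  run p u v q <-> q = (eval_from p.1 u, eval_from p.2 v).
Proof.
split=> [|->].
  elim=> [[]//|{}p a b {}q {}u {}v r]; rewrite inE /= => /eqP -> _ ->.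
  by rewrite !eval_from_cat.
(* The run consumes the whole first tape, then the second. *)
elim: u p => [|a u IH] p.
  elim: v p => [[x y]|b v IH p]; first exact: run_nil.
  apply: (@run_step _ value_afsa p None (Some b)
    (p.1, step_mul p.2 (Some b)) [::] v).
    by rewrite inE; case: (p.1).
  exact: IH.
apply: (@run_step _ value_afsa p (Some a) None
  (step_mul p.1 (Some a), p.2) u v).
  by rewrite inE /=; case: (p.2).
exact: IH.
Qed.

Lemma val_eval_from u : omap val (eval_from None u) = value u.
Proof.
by case: u => //= a u; elim: u a => //= b u IH a.
Qed.

Lemma accepts_value_afsa u v : accepts value_afsa u v <-> value u = value v.
Proof.
have omap_inj : injective (omap (val : A -> S)).
  by move=> [x|] [y|] //= [/val_inj ->].
split=> [[q qF /run_value_afsa E]|E].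
  by move: qF; rewrite E inE /= -!val_eval_from => /eqP ->.
exists (eval_from None u, eval_from None v); last exact/run_value_afsa.
by rewrite inE /=; apply/eqP/omap_inj; rewrite !val_eval_from.
Qed.

End FiniteRational.

Theorem theorem7 (S : semigroupType) (hS : inverse_semigroup S) :
  rational_word_problem S <-> finite_set (@setT S).
Proof.
split=> [[A genA [M /seteqP [sub1 sub2]]]|finS].
  apply: (@inverse_rational_finite _ hS _ genA M) => u v un vn; split=> h.
    by have [] := sub1 (u, v) (conj (conj un vn) h).
  by have [] := sub2 (u, v) (conj (conj un vn) h).
(* All of S serves as the generating set, so each element is a single letter. *)
have AT s : s \in fset_set (@setT S) by rewrite in_fset_set // inE.
exists (fset_set (@setT S)).
  by move=> s; exists [:: [` AT s]%fset].
exists (value_afsa AT); apply/seteqP.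
by split=> -[u v] [uvn h]; split=> //; apply/(accepts_value_afsa AT).
Qed.
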